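(* Let $A\in\mathbb{C}^{n\times n}$ be a normal matrix with spectrum $\{\lambda_i\}_{i=1}^n$, and let $\widetilde{A}=A+E$ with spectrum $\{\widetilde{\lambda}_i\}_{i=1}^n$, where $E\in\mathbb{C}^{n\times n}$ is an arbitrary perturbation. Let $\widetilde{U}\in\mathscr{U}_n(\widetilde{A})$ and $\Delta=\mathcal{U}(\widetilde{U}^{\ast}\widetilde{A}\widetilde{U})$. Then there is a permutation $\pi$ of $\{1,\ldots,n\}$ such that, with $\mathbb{D}_2=\big(\sum_{i=1}^{n}|\widetilde{\lambda}_{\pi(i)}-\lambda_i|^2\big)^{1/2}$, all of the following hold: \begin{align*} \mathbb{D}_{2}&\leq\sqrt{\|E\|_{F}^{2}+(n-1)\delta(E)^{2}},\\ \mathbb{D}_{2}&\leq\sqrt{\|E\|_{F}^{2}+\sqrt{n}\,\delta(E)\|\Delta\|_{F}},\\ \mathbb{D}_{2}&\leq\sqrt{\|E\|_{F}^{2}+2\delta(E)\|\Delta\|_{F}+\|\Delta\|_{F}^{2}},\\ \mathbb{D}_{2}&\leq\sqrt{\|E\|_{F}^{2}+2\sqrt{n-1}\,\delta(E)\|\Delta\|_{F}-\|\Delta\|_{F}^{2}},\\ \mathbb{D}_{2}&\leq\sqrt{\|E\|_{F}^{2}+\frac{n-1}{n}\delta(A)^{2}},\\ \mathbb{D}_{2}&\leq\sqrt{\|E\|_{F}^{2}+2\sqrt{\frac{n-1}{n}}\,\delta(A)\|\Delta\|_{F}-\|\Delta\|_{F}^{2}}. \end{align*}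
   Context: Spectra are listed with algebraic multiplicity. $\|\cdot\|_F$ is the Frobenius norm, $X^{\ast}$ is the conjugate transpose, and $\mathrm{tr}$ is the trace. A matrix $A$ is normal if $AA^{\ast}=A^{\ast}A$. For $M\in\mathbb{C}^{n\times n}$, $\mathcal{U}(M)$ denotes the strictly upper triangular part of $M$ (entries with $i<j$ kept, all others set to $0$), $\delta(M):=\big(\|M\|_F^2-\frac1n|\mathrm{tr}(M)|^2\big)^{1/2}$ (the quantity in parentheses is always nonnegative), and $\mathscr{U}_n(M)$ denotes the set of all $n\times n$ unitary matrices $U$ such that $U^{\ast}MU$ is upper triangular. *)

(* Defs.v *)
From mathcomp Require Import all_boot all_order all_algebra all_fingroup.
From mathcomp Require Import reals.
From mathcomp Require Export complex.

Set Implicit Arguments.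
Unset Strict Implicit.
Unset Printing Implicit Defensive.

Import Order.TTheory GRing.Theory Num.Theory Num.Def.
Local Open Scope ring_scope.
Local Open Scope sesquilinear_scope.

(* Norms and square roots are C-valued.  In the order of a numClosedFieldType,
   [0 <= x <= sqrtC y] with [y] real forces [0 <= y], so such an inequality
   includes the assertion that the radicand is nonnegative. *)
Section MatrixQuantities.
Context {C : numClosedFieldType} {n : nat}.
Implicit Types (M U : 'M[C]_n) (l : 'I_n -> C).

Definition frobenius_norm M : C := sqrtC (\sum_i \sum_j `|M i j| ^+ 2).

Definition delta M : C :=
  sqrtC (frobenius_norm M ^+ 2 - n%:R^-1 * `|\tr M| ^+ 2).

Definition strict_upper_part M : 'M[C]_n :=
  \matrix_(i, j) (if (i < j)%N then M i j else 0).

Definition upper_triangular M : Prop :=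
  forall i j : 'I_n, (j < i)%N -> M i j = 0.

Definition schur_unitary M U : Prop :=
  U \is unitarymx /\ upper_triangular (U^t* *m M *m U).

Definition has_spectrum M l : Prop :=
  char_poly M = \prod_i ('X - (l i)%:P).

Definition spectral_distance2 l l' (p : 'S_n) : C :=
  sqrtC (\sum_i `|l' (p i) - l i| ^+ 2).

End MatrixQuantities.

(* Main.v *)
Require Import Defs.
From mathcomp Require Import all_boot all_order all_algebra all_fingroup.
From mathcomp Require Import reals.
From mathcomp Require Import ring.

Set Implicit Arguments.
Unset Strict Implicit.
Unset Printing Implicit Defensive.

Import Order.TTheory GRing.Theory Num.Theory Num.Def.
Local Open Scope ring_scope.
Local Open Scope sesquilinear_scope.

(** Let [T = U^t* *m (A + E) *m U] be the given Schur form, and let [N] and [G]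
    be the conjugates of [A] and [E] by [U], so that [T = N + G].  Two facts carry
    the proof.

    The first one bounds the distance of the spectra.  For the diagonal [d] of
    [T], which lists the spectrum of [A + E], the matrix [diag_mx d - N]
    coincides with [G] on and below the diagonal, because [T] vanishes below
    it, and with [- N] above.  Its squared norm is therefore
    [||E||^2 + ||U(N)||^2 - ||U(G)||^2], with [U(M)] the strictly upper part
    of [M].  The Hoffman-Wielandt argument ([normalmx_diag_matching]) finds a
    matching of [d] with the spectrum of [N] whose squared cost is at most that
    norm: written in an eigenbasis of [N], the norm averages the costs of the
    pairs with doubly stochastic weights, and such an average is at least the
    cost of some permutation ([cost_le_perm]).  The latter is the part of
    Birkhoff's theorem that is needed; it is proved by moving a doubly
    stochastic matrix along a perturbation with zero line sums until an entry
    vanishes.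

    The second one compares the two triangular parts of the normal matrix [N]:
    [||U(N)||^2 <= (n - 1) * ||L(N)||^2] ([normalmx_strict_upper_le]), because
    the blocks that each cut of the index set leaves above and below the
    diagonal have equal norms.  As [T] is upper triangular, [L(N) = - L(G)].

    All the bounds then follow from the triangle inequality applied to
    [U(N) + U(G) = Delta], and from the fact that the off-diagonal part of a
    matrix has norm at most [delta] ([delta_sqr_ge]). *)

(** * The linear assignment problem over doubly stochastic matrices *)

Section AssignmentProblem.
Context {F : realFieldType}.

(** A matrix supported on [P] has [#|P|] free entries, while its row and column
    sums impose [n + n] equations which are dependent, as both families of sums
    add up to the total of the entries.  So [n + n] cells leave room for a
    nonzero solution. *)
Lemma exists_balanced_matrix n (P : {set 'I_n * 'I_n}) :
    (0 < n)%N -> (n + n <= #|P|)%N ->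
  exists X : 'M[F]_n, [/\ X != 0,
    forall i j, (i, j) \notin P -> X i j = 0,
    forall i, \sum_j X i j = 0 & forall j, \sum_i X i j = 0].
Proof.
move=> n_gt0 leP.
(* Row [k] of [K] marks the two line sums that the [k]-th cell of [P] enters. *)
pose K : 'M[F]_(#|P|, n + n) := row_mx
  (\matrix_(k, i) ((enum_val k).1 == i)%:R)
  (\matrix_(k, j) ((enum_val k).2 == j)%:R).
have sum_indic (a : 'I_n) : \sum_j (a == j)%:R = 1 :> F.
  by rewrite (bigD1 a) //= eqxx big1 ?addr0 // => j /negPf; rewrite eq_sym => ->.
have rankK : (\rank K < #|P|)%N.
  apply: leq_trans leP.
  (* Row sums minus column sums: the relation that lowers the rank by 1. *)
  pose v : 'cV[F]_(n + n) := col_mx (const_mx 1) (const_mx (-1)).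
  have Kv0 : K *m v = 0.
    rewrite mul_row_col; apply/matrixP => k z; rewrite !mxE.
    under eq_bigr do rewrite !mxE mulr1.
    under [X in _ + X]eq_bigr do rewrite !mxE mulrN1.
    by rewrite sumrN !sum_indic subrr.
  have v_neq0 : v != 0.
    apply/eqP => /(congr1 usubmx); rewrite col_mxKu => /matrixP.
    move=> /(_ (Ordinal n_gt0) 0); rewrite !mxE => /eqP.
    by rewrite oner_eq0.
  have := mulmx0_rank_max Kv0; rewrite -mxrank_eq0 -lt0n in v_neq0 *.
  by apply: leq_trans; rewrite -addn1 leq_add2l.
have : kermx K != 0 by rewrite kermx_eq0 /row_free neq_ltn rankK.
case/rowV0Pn => x /sub_kermxP xK0 x_neq0.
pose X : 'M[F]_n := \matrix_(i, j) \sum_k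
  x 0 k * (((enum_val k).1 == i)%:R * ((enum_val k).2 == j)%:R).
have cellE k i j : ((enum_val k).1 == i)%:R * ((enum_val k).2 == j)%:R
    = (enum_val k == (i, j))%:R :> F.
  by rewrite -natrM mulnb -xpair_eqE -surjective_pairing.
have XE k : X (enum_val k).1 (enum_val k).2 = x 0 k.
  rewrite mxE (bigD1 k) //= !eqxx !mulr1 big1 ?addr0 // => l.
  rewrite cellE -surjective_pairing (inj_eq enum_val_inj) => /negPf ->.
  by rewrite mulr0.
exists X; split.
- apply: contraNneq x_neq0 => X0; apply/eqP/rowP => k.
  by rewrite -XE X0 !mxE.
- move=> i j ijP; rewrite mxE big1 // => k _; rewrite cellE.
  case: eqP => [ek|]; last by rewrite mulr0.
  by move: ijP; rewrite -ek enum_valP.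
- move=> i; have /matrixP/(_ 0 (lshift n i)) := xK0.
  rewrite mul_mx_row row_mxEl !mxE => xKi; rewrite -[RHS]xKi.
  under eq_bigr do rewrite mxE.
  rewrite exchange_big; apply: eq_bigr => k _ /=.
  by rewrite -2!mulr_sumr sum_indic mulr1 mxE.
- move=> j; have /matrixP/(_ 0 (rshift n j)) := xK0.
  rewrite mul_mx_row row_mxEr !mxE => xKj; rewrite -[RHS]xKj.
  under eq_bigr do rewrite mxE.
  rewrite exchange_big; apply: eq_bigr => k _ /=.
  by rewrite -mulr_sumr -mulr_suml sum_indic mul1r mxE.
Qed.

Definition doubly_stochastic n (S : 'M[F]_n) :=
  [/\ forall i j, 0 <= S i j, forall i, \sum_j S i j = 1
    & forall j, \sum_i S i j = 1].

Definition cost n (c S : 'M[F]_n) := \sum_i \sum_j S i j * c i j.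

Definition mx_support n (S : 'M[F]_n) := [set ij | S ij.1 ij.2 != 0].

Lemma costD n (c S T : 'M[F]_n) : cost c (S + T) = cost c S + cost c T.
Proof.
rewrite /cost -big_split; apply: eq_bigr => i _ /=.
by rewrite -big_split; apply: eq_bigr => j _; rewrite mxE mulrDl.
Qed.

Lemma costZ n (c S : 'M[F]_n) a : cost c (a *: S) = a * cost c S.
Proof.
rewrite /cost mulr_sumr; apply: eq_bigr => i _.
by rewrite mulr_sumr; apply: eq_bigr => j _; rewrite mxE mulrA.
Qed.

(** Moving along a balanced matrix [X], in the direction that does not lower the
    cost, keeps the line sums.  As [X] has a negative entry, the move first
    leaves the nonnegative matrices at some positive time, when an entry of [S]
    vanishes. *)
Lemma reduce_support n (c S : 'M[F]_n) :
    (0 < n)%N -> doubly_stochastic S -> (n + n <= #|mx_support S|)%N ->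
  exists S', [/\ doubly_stochastic S',
    (#|mx_support S'| < #|mx_support S|)%N & cost c S <= cost c S'].
Proof.
move=> n_gt0 [S_ge0 Srow Scol] /(exists_balanced_matrix n_gt0).
move=> [X0 [X0_neq0 X0supp X0row X0col]].
have [X [X_neq0 Xsupp Xrow Xcol cX_ge0]] : exists X : 'M[F]_n, [/\ X != 0,
    forall i j, S i j = 0 -> X i j = 0, forall i, \sum_j X i j = 0,
    forall j, \sum_i X i j = 0 & 0 <= cost c X].
  have {}X0supp i j : S i j = 0 -> X0 i j = 0.
    by move=> Sij; apply: X0supp; rewrite inE /= Sij eqxx.
  have [cX0|/ltW cX0] := leP 0 (cost c X0); first by exists X0.
  exists (- X0); rewrite oppr_eq0; split=> //.
  - by move=> i j /X0supp Xij; rewrite mxE Xij oppr0.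
  - by move=> i; under eq_bigr do rewrite mxE; rewrite sumrN X0row oppr0.
  - by move=> j; under eq_bigr do rewrite mxE; rewrite sumrN X0col oppr0.
  - by rewrite -scaleN1r costZ mulN1r oppr_ge0.
have [ab Xab_lt0] : exists ab : 'I_n * 'I_n, X ab.1 ab.2 < 0.
  apply/existsP; apply: contraNT X_neq0; rewrite negb_exists => /forallP X_ge0.
  have {}X_ge0 i j : 0 <= X i j by rewrite leNgt (X_ge0 (i, j)).
  apply/eqP/matrixP => i j; rewrite mxE.
  exact: (psumr_eq0P (fun j _ => X_ge0 i j) (Xrow i)).
pose ratio (ij : 'I_n * 'I_n) := S ij.1 ij.2 / - X ij.1 ij.2.
case: (@arg_minP _ _ _ ab (fun ij => X ij.1 ij.2 < 0) ratio Xab_lt0).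
move=> ij Xij_lt0 ij_min; set t := ratio ij in ij_min.
have t_ge0 : 0 <= t by rewrite divr_ge0 // oppr_ge0 ltW.
have S'E i j : (S + t *: X) i j = S i j + t * X i j by rewrite !mxE.
exists (S + t *: X); split; first split.
- move=> i j; rewrite S'E; have [Xij_ge0|Xij'_lt0] := leP 0 (X i j).
    by apply: addr_ge0 => //; apply: mulr_ge0.
  have := ij_min (i, j) Xij'_lt0; rewrite /ratio /= ler_pdivlMr ?oppr_gt0 //.
  by rewrite mulrN -subr_ge0 opprK.
- move=> i; under eq_bigr do rewrite S'E.
  by rewrite big_split /= -mulr_sumr Xrow Srow mulr0 addr0.
- move=> j; under eq_bigr do rewrite S'E.
  by rewrite big_split /= -mulr_sumr Xcol Scol mulr0 addr0.
- apply/proper_card/properP; split.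
    apply/subsetP => kl; rewrite !inE S'E; apply: contra => /eqP Skl0.
    by rewrite Skl0 (Xsupp _ _ Skl0) mulr0 addr0.
  exists ij; rewrite inE ?S'E.
    by apply: contraTneq Xij_lt0 => /Xsupp ->; rewrite ltxx.
  by rewrite negbK /t /ratio invrN mulrN mulNr divfK ?subrr // lt_eqF.
- by rewrite costD costZ lerDl; apply: mulr_ge0.
Qed.

(** Either the support is large and can be reduced, or some row has a single
    nonzero entry, which is then 1 and alone in its column too; deleting its row
    and its column lowers the dimension. *)
Lemma cost_le_perm n (c S : 'M[F]_n) :
  doubly_stochastic S -> exists p : 'S_n, cost c S <= \sum_i c i (p i).
Proof.
elim: n c S => [|n IHn] c S.
  by move=> _; exists 1%g; rewrite /cost !big_ord0.
have [m] := ubnP #|mx_support S|; elim: m S => // m IHm S ltm dsS.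
have [ge2n|lt2n] := leqP (n.+1 + n.+1) #|mx_support S|.
  have [S' [dsS' ltS' leS']] := reduce_support c (ltn0Sn n) dsS ge2n.
  have [p leSp] := IHm S' (leq_trans ltS' ltm) dsS'.
  by exists p; apply: le_trans leSp.
have [S_ge0 Srow Scol] := dsS.
have [a a1] : exists a, (#|[set j | (S a j != 0)%R]| <= 1)%N.
  apply/existsP; apply: contraTT lt2n; rewrite negb_exists => /forallP ge2.
  rewrite -leqNgt addnn -muln2 -[X in (X * 2)%N](card_ord n.+1) -sum_nat_const.
  have -> : #|mx_support S| = (\sum_i #|[set j | (S i j != 0)%R]|)%N.
    under eq_bigr do rewrite -sum1dep_card.
    rewrite pair_big_dep -sum1_card.
    by apply: eq_bigl => ij; rewrite inE.
  by apply: leq_sum => i _; rewrite ltnNge ge2.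
have [b Sab_neq0] : exists b, S a b != 0.
  apply/existsP; apply: contraT; rewrite negb_exists => /forallP Sa0.
  have := Srow a; rewrite big1 => [/eqP|j _]; first by rewrite eq_sym oner_eq0.
  by apply/eqP; rewrite -[_ == _]negbK Sa0.
have Sa0 j : j != b -> S a j = 0.
  move=> jb; apply/eqP; apply: contraNT jb => Saj.
  by apply/eqP/(card_le1_eqP a1); rewrite inE.
have Sab : S a b = 1.
  by rewrite -(Srow a) (bigD1 b) //= big1 ?addr0 // => j /Sa0.
have Sb0 i : i != a -> S i b = 0.
  have := Scol b; rewrite (bigD1 a) //= Sab => /(canRL (addKr _)).
  rewrite addNr => sum0 ia.
  exact: (psumr_eq0P (fun i _ => S_ge0 i b) sum0).
have lift_neq (k : 'I_n.+1) i : lift k i != k by rewrite eq_sym neq_lift.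
have splitE (f : 'I_n.+1 -> F) k : \sum_i f i = f k + \sum_i f (lift k i).
  by rewrite (bigD1_ord k).
pose S' : 'M[F]_n := row' a (col' b S); pose c' : 'M[F]_n := row' a (col' b c).
have dsS' : doubly_stochastic S'.
  split=> [i j|i|j]; first by rewrite !mxE.
  - rewrite -(Srow (lift a i)) [RHS](splitE _ b) Sb0 ?lift_neq // add0r.
    by apply: eq_bigr => j _; rewrite !mxE.
  - rewrite -(Scol (lift b j)) [RHS](splitE _ a) Sa0 ?lift_neq // add0r.
    by apply: eq_bigr => i _; rewrite !mxE.
have [p leSp] := IHn c' S' dsS'.
exists (lift_perm a b p); rewrite (splitE _ a) lift_perm_id.
rewrite /cost (splitE _ a); apply: lerD.
  rewrite (splitE _ b) Sab mul1r big1 ?addr0 // => j _.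
  by rewrite Sa0 ?mul0r ?lift_neq.
apply: le_trans (_ : cost c' S' <= _).
  apply: ler_sum => i _; rewrite (splitE _ b) Sb0 ?lift_neq //.
  rewrite mul0r add0r; apply: ler_sum => j _.
  by rewrite !mxE.
apply: le_trans leSp _; apply: ler_sum => i _.
by rewrite lift_perm_lift !mxE.
Qed.

End AssignmentProblem.

(** * Frobenius norms of matrices and of their triangular parts *)

Section FrobeniusNorm.
Context {C : numClosedFieldType} {n : nat}.
Implicit Types (M U : 'M[C]_n).

Lemma frobenius_norm_sqr M :
  frobenius_norm M ^+ 2 = \sum_i \sum_j `|M i j| ^+ 2.
Proof. exact: sqrtCK. Qed.

Lemma frobenius_norm_ge0 M : 0 <= frobenius_norm M.
Proof.
rewrite sqrtC_ge0 sumr_ge0 // => i _; rewrite sumr_ge0 // => j _.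
exact: exprn_ge0.
Qed.

(** This makes the triangle inequality of the Hermitian product on row vectors
    available. *)
Lemma frobenius_norm_dotmx M :
  frobenius_norm M = sqrtC (dotmx (mxvec M) (mxvec M)).
Proof.
rewrite dotmxE mxE (reindex _ (curry_mxvec_bij _ _)) /=; congr sqrtC.
rewrite pair_bigA; apply: eq_bigr => -[i j] _ /=.
by rewrite !mxE mxvecE normCK.
Qed.

Lemma frobenius_normD_le M1 M2 :
  frobenius_norm (M1 + M2) <= frobenius_norm M1 + frobenius_norm M2.
Proof. by rewrite !frobenius_norm_dotmx linearD triangle_lerif. Qed.

Lemma frobenius_normN M : frobenius_norm (- M) = frobenius_norm M.
Proof.
by congr sqrtC; do 2!apply: eq_bigr => ? _; rewrite mxE normrN.
Qed.

Lemma frobenius_norm_sqr_tr M : frobenius_norm M ^+ 2 = \tr (M *m M^t*).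
Proof.
rewrite frobenius_norm_sqr; apply: eq_bigr => i _; rewrite mxE.
by apply: eq_bigr => j _; rewrite !mxE normCK.
Qed.

Lemma frobenius_norm_mulmx_unitary M U :
  U \is unitarymx -> frobenius_norm (M *m U) ^+ 2 = frobenius_norm M ^+ 2.
Proof.
move=> unU; rewrite !frobenius_norm_sqr_tr trmx_mul map_mxM.
by rewrite mulmxA mulmxtVK.
Qed.

Lemma frobenius_norm_conjugate M U :
  U \is unitarymx -> frobenius_norm (U^t* *m M *m U) = frobenius_norm M.
Proof.
move=> unU; apply: (pexpIrn (n := 2)); rewrite ?nnegrE ?frobenius_norm_ge0 //.
rewrite frobenius_norm_mulmx_unitary // !frobenius_norm_sqr_tr.
rewrite trmx_mul map_mxM trmxCK mxtrace_mulC !mulmxA.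
by rewrite mulmxtVK // mxtrace_mulC.
Qed.

Lemma mxtrace_conjugate M U :
  U \is unitarymx -> \tr (U^t* *m M *m U) = \tr M.
Proof. by move=> unU; rewrite mxtrace_mulC mulmxA (unitarymxP unU) mul1mx. Qed.

Lemma delta_conjugate M U :
  U \is unitarymx -> delta (U^t* *m M *m U) = delta M.
Proof.
by move=> unU; rewrite /delta frobenius_norm_conjugate ?mxtrace_conjugate.
Qed.

(** The part of [M] below the diagonal enters through the transpose, as
    [strict_upper_part M^T]. *)
Lemma frobenius_norm_split M :
  frobenius_norm M ^+ 2 = \sum_i `|M i i| ^+ 2
    + (frobenius_norm (strict_upper_part M) ^+ 2
       + frobenius_norm (strict_upper_part M^T) ^+ 2).
Proof.
rewrite !frobenius_norm_sqr [X in _ + (_ + X)]exchange_big -!big_split /=.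
apply: eq_bigr => i _; rewrite -big_split /= (bigD1 i) //=.
rewrite [in RHS](bigD1 i) //= !mxE ltnn normr0 expr0n !addr0 add0r.
congr (_ + _); apply: eq_bigr => j; rewrite !mxE -val_eqE /=.
by case: ltngtP => // _ _; rewrite normr0 expr0n ?addr0 ?add0r.
Qed.

Lemma mxtrace_sqr_le M : `|\tr M| ^+ 2 <= n%:R * \sum_i `|M i i| ^+ 2.
Proof.
pose d : 'rV[C]_n := \row_i M i i.
have -> : \tr M = dotmx d (const_mx 1).
  rewrite dotmxE mxE; apply: eq_bigr => i _.
  by rewrite !mxE rmorph1 mulr1.
have [/= le_CS _] := CauchySchwarz (@dotmx C n) d (const_mx 1).
apply: le_trans le_CS _.
suff [/= -> ->] : dotmx d d = \sum_i `|M i i| ^+ 2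
    /\ dotmx (const_mx 1) (const_mx 1 : 'rV_n) = n%:R :> C by rewrite mulrC.
rewrite !dotmxE !mxE; split; first by apply: eq_bigr => i _; rewrite !mxE normCK.
under eq_bigr do rewrite !mxE rmorph1 mulr1.
by rewrite sumr_const card_ord.
Qed.

(** The diagonal carries at least the share [`|\tr M| ^+ 2 / n] that [delta M]
    removes from the squared norm. *)
Lemma delta_sqr_ge M : (0 < n)%N ->
  frobenius_norm (strict_upper_part M) ^+ 2
    + frobenius_norm (strict_upper_part M^T) ^+ 2 <= delta M ^+ 2.
Proof.
move=> n_gt0; rewrite [delta M ^+ 2]sqrtCK (frobenius_norm_split M).
rewrite addrAC lerDr subr_ge0.
by rewrite ler_pdivrMl ?ltr0n // mxtrace_sqr_le.
Qed.

Lemma delta_ge0 M : (0 < n)%N -> 0 <= delta M.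
Proof.
move=> n_gt0; rewrite sqrtC_ge0 -[X in 0 <= X]sqrtCK.
apply: le_trans (delta_sqr_ge M n_gt0).
by rewrite addr_ge0 ?exprn_ge0 ?frobenius_norm_ge0.
Qed.

(** * Triangular parts of normal matrices *)

(** Row [i] and column [i] of a normal matrix have the same norm.  Summing over
    [i < k] and cancelling the common leading block shows that the block above
    and to the right of the cut [k] has the norm of its mirror image. *)
Lemma normalmx_cut M k : M \is normalmx ->
  \sum_(i < n | (i < k)%N) \sum_(j < n | (k <= j)%N) `|M i j| ^+ 2 =
  \sum_(i < n | (i < k)%N) \sum_(j < n | (k <= j)%N) `|M j i| ^+ 2.
Proof.
move=> /normalmxP nM.
have line i : \sum_j `|M i j| ^+ 2 = \sum_j `|M j i| ^+ 2.
  have /matrixP/(_ i i) := nM; rewrite !mxE.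
  under eq_bigr do rewrite !mxE -normCK.
  by under [X in _ = X -> _]eq_bigr do rewrite !mxE -normCKC.
apply: (addrI (\sum_(i < n | (i < k)%N) \sum_(j < n | (j < k)%N) `|M i j| ^+ 2)).
rewrite [X in _ = X + _]exchange_big -!big_split /=; apply: eq_bigr => i _.
have := line i; rewrite (bigID (fun j : 'I_n => (j < k)%N)).
rewrite [RHS](bigID (fun j : 'I_n => (j < k)%N)) /=.
have geE (j : 'I_n) : ~~ (j < k)%N = (k <= j)%N by rewrite -leqNgt.
by rewrite !(eq_bigl _ _ geE).
Qed.

(** The blocks of the [n - 1] cuts are summed up.  A cell above the diagonal lies
    in at least one of them, and a cell below it in at most [n - 1] mirror
    images. *)
Lemma normalmx_strict_upper_le M : M \is normalmx -> (0 < n)%N ->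
  frobenius_norm (strict_upper_part M) ^+ 2
    <= (n%:R - 1) * frobenius_norm (strict_upper_part M^T) ^+ 2.
Proof.
move=> nM n_gt0.
have -> : n%:R - 1 = n.-1%:R :> C by rewrite -subn1 natrB.
(* [w i j] counts the cuts that separate [i] from [j]; the cut 0 separates
   nothing. *)
pose w (i j : nat) := #|[set k : 'I_n | (i < k <= j)%N]|.
pose W (N : 'M[C]_n) := \sum_i \sum_j `|N i j| ^+ 2 * (w i j)%:R.
have WE N : W N = \sum_(k < n)
    \sum_(i < n | (i < k)%N) \sum_(j < n | (k <= j)%N) `|N i j| ^+ 2.
  under [RHS]eq_bigr do rewrite pair_big /= big_mkcond.
  rewrite exchange_big /W pair_bigA; apply: eq_bigr => -[i j] _ /=.
  rewrite -big_mkcond sumr_const mulr_natr; congr (_ *+ _).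
  by apply: eq_card => k; rewrite !inE.
have W_tr : W M = W M^T.
  rewrite !WE; apply: eq_bigr => k _; rewrite normalmx_cut //.
  by do 2!apply: eq_bigr => ? _; rewrite mxE.
apply: le_trans (_ : W M <= _).
  rewrite frobenius_norm_sqr; apply: ler_sum => i _; apply: ler_sum => j _.
  rewrite mxE.
  case: ifP => [lt_ij|_]; last by rewrite normr0 expr0n mulr_ge0 ?exprn_ge0.
  rewrite ler_peMr ?exprn_ge0 // ler1n card_gt0; apply/set0Pn.
  by exists j; rewrite inE lt_ij leqnn.
rewrite W_tr frobenius_norm_sqr mulr_sumr; apply: ler_sum => i _.
rewrite mulr_sumr; apply: ler_sum => j _.
rewrite [in leRHS]mxE.
case: ifP => [lt_ij|/negbT nlt_ij]; last first.
  rewrite normr0 expr0n mulr0; suff -> : w i j = 0%N by rewrite mulr0.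
  apply: eq_card0 => k; rewrite inE; apply: contraNF nlt_ij.
  by case/andP; apply: leq_trans.
rewrite mulrC ler_wpM2r ?exprn_ge0 // ler_nat.
apply: leq_trans (subset_leq_card (B := [set~ Ordinal n_gt0]) _) _.
  apply/subsetP => k; rewrite !inE -val_eqE /= -lt0n => /andP[+ _].
  exact: leq_trans.
by rewrite cardsC1 card_ord.
Qed.

End FrobeniusNorm.

(** * Spectra *)

Section Spectra.
Context {C : numClosedFieldType} {n : nat}.
Implicit Types (M U : 'M[C]_n) (l : 'I_n -> C).

Lemma char_poly_conjugate M U :
  U \is unitarymx -> char_poly (U^t* *m M *m U) = char_poly M.
Proof.
move=> unU; pose V := map_mx (@polyC C) U.
pose W := map_mx (@polyC C) (U^t*).
have UU1 : W *m V = 1%:M.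
  by rewrite -map_mxM (mulmx1C (unitarymxP unU)) map_mx1.
rewrite /char_poly; suff -> : char_poly_mx (U^t* *m M *m U)
    = W *m char_poly_mx M *m V.
  by rewrite !det_mulmx mulrAC -det_mulmx UU1 det1 mul1r.
rewrite /char_poly_mx mulmxBr mulmxBl !map_mxM; congr (_ - _).
by rewrite scalar_mxC -mulmxA UU1 mulmx1.
Qed.

Lemma char_poly_upper_triangular M :
  upper_triangular M -> has_spectrum M (fun i => M i i).
Proof.
move=> upM; rewrite /has_spectrum /char_poly -det_tr.
have -> : (char_poly_mx M)^T = char_poly_mx M^T.
  by rewrite /char_poly_mx linearB /= tr_scalar_mx map_trmx.
rewrite -/(char_poly _) char_poly_trig; last first.
  by apply/is_trig_mxP => i j lt_ij; rewrite mxE upM.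
by apply: eq_bigr => i _; rewrite mxE.
Qed.

Lemma spectrum_unique M l l' : has_spectrum M l -> has_spectrum M l' ->
  exists s : 'S_n, forall i, l' i = l (s i).
Proof.
rewrite /has_spectrum => -> /esym eq_prod.
have : perm_eq [tuple l' i | i < n] [tuple l i | i < n].
  by apply: prod_XsubC_eq; rewrite !big_map -enumT !big_enum.
case/tuple_permP => s /val_inj eq_l; exists s => i.
by have := congr1 (fun t => tnth t i) eq_l; rewrite !tnth_mktuple.
Qed.

End Spectra.

Section NormalMatching.
Context {R : rcfType} {n : nat}.
Implicit Types (A : 'M[R[i]]_n) (lam : 'I_n -> R[i]) (d : 'rV[R[i]]_n).

(** In an eigenbasis [P] of [A], the squared distance from [A] to a diagonal
    matrix averages the costs [`|d i - lam k| ^+ 2] with the weights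
    [`|P k i| ^+ 2], which form a doubly stochastic matrix since [P] is
    unitary.  Some permutation costs at most such an average. *)
Lemma normalmx_diag_matching A lam d : A \is normalmx -> has_spectrum A lam ->
  exists q : 'S_n,
    \sum_i `|d 0 i - lam (q i)| ^+ 2 <= frobenius_norm (diag_mx d - A) ^+ 2.
Proof.
move=> /orthomx_spectralP AE spec_lam.
set P := spectralmx A in AE; set sp := spectral_diag A in AE.
have unP : P \is unitarymx := spectral_unitarymx A.
have unPt : P^t* \is unitarymx by rewrite trmxC_unitary.
rewrite invmx_unitary // in AE.
have [s spE] : exists s : 'S_n, forall i, sp 0 i = lam (s i).
  apply: spectrum_unique spec_lam _.
  rewrite /has_spectrum AE char_poly_conjugate // char_poly_upper_triangular.
    by apply: eq_bigr => i _; rewrite mxE eqxx.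
  by move=> i j lt_ji; rewrite mxE -val_eqE /= gtn_eqF.
pose sqn (z : R[i]) : R := complex.Re z ^+ 2 + complex.Im z ^+ 2.
have sqnE z : `|z| ^+ 2 = (sqn z)%:C%C by rewrite add_Re2_Im2.
pose S : 'M[R]_n := \matrix_(i, k) sqn (P k i).
(* The sign turns the maximal value over permutations into a minimal cost. *)
pose c : 'M[R]_n := \matrix_(i, k) - sqn (d 0 i - sp 0 k).
(* The entries of [(diag_mx d - A) *m P^t*] are [(P k i)^* * (d i - sp k)]. *)
have distE : frobenius_norm (diag_mx d - A) ^+ 2 = (- cost c S)%:C%C.
  rewrite -(frobenius_norm_mulmx_unitary _ unPt) mulmxBl AE mulmxtVK //.
  rewrite mul_diag_mx mul_mx_diag frobenius_norm_sqr /cost -sumrN rmorph_sum.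
  apply: eq_bigr => i _; rewrite -sumrN rmorph_sum; apply: eq_bigr => k _.
  rewrite !mxE mulrN opprK rmorphM /= -!sqnE -exprMn -normrM.
  by rewrite [d 0 i * _]mulrC -mulrBr !normrM norm_conjC.
have dsS : doubly_stochastic S.
  split.
  - by move=> i k; rewrite mxE addr_ge0 ?sqr_ge0.
  - move=> i; apply: (@complexI R); rewrite rmorph_sum rmorph1.
    have /unitarymxP/matrixP/(_ i i) := unPt; rewrite !mxE eqxx => sum1.
    rewrite -[RHS]sum1.
    by apply: eq_bigr => k _; rewrite /= !mxE conjCK -sqnE normCKC.
  - move=> k; apply: (@complexI R); rewrite rmorph_sum rmorph1.
    have /unitarymxP/matrixP/(_ k k) := unP; rewrite !mxE eqxx => sum1.
    rewrite -[RHS]sum1.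
    by apply: eq_bigr => i _; rewrite /= !mxE -sqnE normCK.
have [p le_p] := cost_le_perm c dsS.
exists (p * s)%g; rewrite distE.
rewrite (_ : \sum_i _ = (- \sum_i c i (p i))%:C%C) ?lecR ?lerN2 //.
rewrite -sumrN rmorph_sum; apply: eq_bigr => i _.
by rewrite /= mxE opprK permM -spE sqnE.
Qed.

End NormalMatching.

(** * Perturbation of a normal matrix *)

Section UpperParts.
Context {C : numClosedFieldType} {n : nat}.
Implicit Types (M N G U : 'M[C]_n).

Lemma strict_upper_partD M N :
  strict_upper_part (M + N) = strict_upper_part M + strict_upper_part N.
Proof. by apply/matrixP => i j; rewrite !mxE; case: ifP; rewrite ?addr0. Qed.

Lemma strict_upper_partN M : strict_upper_part (- M) = - strict_upper_part M.
Proof. by apply/matrixP => i j; rewrite !mxE; case: ifP; rewrite ?oppr0. Qed.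

Lemma normalmx_conjugate M U :
  U \is unitarymx -> M \is normalmx -> U^t* *m M *m U \is normalmx.
Proof.
move=> unU /normalmxP nM; apply/normalmxP.
rewrite !(trmx_mul, map_mxM) trmxCK /= !mulmxA !(mulmxtVK _ unU).
by rewrite -[U^t* *m M *m _]mulmxA nM mulmxA.
Qed.

Lemma strict_lower_part_perturbation N G : upper_triangular (N + G) ->
  strict_upper_part N^T = - strict_upper_part G^T.
Proof.
move=> upNG; apply/matrixP => i j; rewrite !mxE; case: ifP => [lt_ij|_].
  by have := upNG _ _ lt_ij; rewrite mxE => /(canRL (addrK _)); rewrite add0r.
by rewrite oppr0.
Qed.

(** Off the diagonal, [diag (N + G) - N] is [- N] above and [G] below. *)
Lemma frobenius_norm_diag_sub N G : upper_triangular (N + G) ->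
  frobenius_norm (diag_mx (\row_i (N + G) i i) - N) ^+ 2 =
  frobenius_norm G ^+ 2 + frobenius_norm (strict_upper_part N) ^+ 2
    - frobenius_norm (strict_upper_part G) ^+ 2.
Proof.
move=> upNG; set D := diag_mx _.
have upD : strict_upper_part D = 0.
  apply/matrixP => i j; rewrite !mxE -val_eqE /=.
  by case: ltngtP; rewrite ?mulr0n.
have diagE : \sum_i `|(D - N) i i| ^+ 2 = \sum_i `|G i i| ^+ 2.
  by apply: eq_bigr => i _; rewrite !mxE eqxx mulr1n addrC addKr.
have lowE : strict_upper_part (D - N)^T = strict_upper_part G^T.
  rewrite linearB strict_upper_partD strict_upper_partN /= tr_diag_mx upD.
  by rewrite (strict_lower_part_perturbation upNG) opprK add0r.
rewrite (frobenius_norm_split (D - N)) (frobenius_norm_split G) diagE lowE.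
rewrite strict_upper_partD strict_upper_partN upD add0r frobenius_normN.
by ring.
Qed.

End UpperParts.

(** The diagonal of the Schur form lists the spectrum of [A + E], so matching it
    with the spectrum of the conjugate of [A] matches [lamt] with [lam], up to
    relabelling. *)
Lemma spectral_matching_le (R : rcfType) n (A E : 'M[R[i]]_n)
    (lam lamt : 'I_n -> R[i]) (U : 'M[R[i]]_n) :
    A \is normalmx -> has_spectrum A lam -> has_spectrum (A + E) lamt ->
    schur_unitary (A + E) U ->
  exists p : 'S_n, \sum_i `|lamt (p i) - lam i| ^+ 2 <=
    frobenius_norm E ^+ 2
    + frobenius_norm (strict_upper_part (U^t* *m A *m U)) ^+ 2
    - frobenius_norm (strict_upper_part (U^t* *m E *m U)) ^+ 2.
Proof.
move=> nA spA spT [unU]; set N := U^t* *m A *m U; set G := U^t* *m E *m U.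
have TE : U^t* *m (A + E) *m U = N + G by rewrite mulmxDr mulmxDl.
rewrite TE => upT; pose d := \row_i (N + G) i i.
have nN : N \is normalmx by apply: normalmx_conjugate.
have spN : has_spectrum N lam by rewrite /has_spectrum char_poly_conjugate.
have [q le_q] := normalmx_diag_matching d nN spN.
have [s dE] : exists s : 'S_n, forall i, (N + G) i i = lamt (s i).
  apply: (spectrum_unique (M := N + G)); last exact: char_poly_upper_triangular.
  by rewrite -TE /has_spectrum char_poly_conjugate.
exists (q^-1 * s)%g; rewrite -(frobenius_norm_conjugate E unU).
rewrite -frobenius_norm_diag_sub //.
apply: le_trans le_q; rewrite (reindex_perm q) /=; apply: ler_sum => i _.
by rewrite permM permK mxE dE.
Qed.

Section ScalarBounds.
Context {C : numClosedFieldType}.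
Implicit Types a g l x y : C.

Lemma ler_sqrtC_of_le x y : 0 <= x -> x <= y -> sqrtC x <= sqrtC y.
Proof. by move=> x0 le_xy; rewrite ler_sqrtC // nnegrE (le_trans x0). Qed.

Lemma subr_sqr_le a g x : 0 <= g -> 0 <= x -> 0 <= a ->
  a <= x + g -> x <= a + g -> a ^+ 2 - g ^+ 2 <= 2 * a * x - x ^+ 2.
Proof.
move=> g0 x0 a0 leax lexa.
have : `|a - x| ^+ 2 <= g ^+ 2.
  rewrite lerXn2r ?nnegrE // real_ler_norml ?rpredB ?ger0_real //.
  by rewrite lerBrDl lerBlDr lexa lerBlDl leax.
rewrite real_normK ?rpredB ?ger0_real // => le_sq.
rewrite -subr_ge0; move: le_sq; rewrite -subr_ge0.
by congr (0 <= _); ring.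
Qed.

(** Cauchy and Schwarz for the pairs [(s, 1)] and [(l, g)]. *)
Lemma mulD_sqr_le s l g : s \is Num.real -> l \is Num.real -> g \is Num.real ->
  (s * l + g) ^+ 2 <= (s ^+ 2 + 1) * (g ^+ 2 + l ^+ 2).
Proof.
move=> rs rl rg; rewrite -subr_ge0.
have : 0 <= (s * g - l) ^+ 2 by rewrite -realEsqr rpredB ?rpredM.
by congr (0 <= _); ring.
Qed.

End ScalarBounds.

(** Let [a] and [g] be the two norms in [r].  The conjugates of [A] and [E] have
    opposite parts below the diagonal, of common norm [l], so
    [a ^+ 2 <= (n - 1) * l ^+ 2], while [g ^+ 2 + l ^+ 2 <= delta E ^+ 2] and
    [a ^+ 2 + l ^+ 2 <= delta A ^+ 2].  The rest is the triangle inequality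
    between [a], [g] and [x]: the second bound uses
    [r = (a - g) * (a + g) <= x * (a + g)], the third one [a <= x + g], and the
    bounds ending in [- x ^+ 2] use [(a - x) ^+ 2 <= g ^+ 2]. *)
Lemma strict_upper_part_bounds (C : numClosedFieldType) n (A E U : 'M[C]_n) :
    (0 < n)%N -> A \is normalmx -> schur_unitary (A + E) U ->
  let x := frobenius_norm (strict_upper_part (U^t* *m (A + E) *m U)) in
  let r := frobenius_norm (strict_upper_part (U^t* *m A *m U)) ^+ 2
           - frobenius_norm (strict_upper_part (U^t* *m E *m U)) ^+ 2 in
  [/\ r <= (n%:R - 1) * delta E ^+ 2,
      r <= sqrtC n%:R * delta E * x,
      r <= 2 * delta E * x + x ^+ 2,
      r <= 2 * sqrtC (n%:R - 1) * delta E * x - x ^+ 2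
    & r <= (n%:R - 1) / n%:R * delta A ^+ 2 /\
      r <= 2 * sqrtC ((n%:R - 1) / n%:R) * delta A * x - x ^+ 2].
Proof.
move=> hn hA [unU upT].
have TE : U^t* *m (A + E) *m U = U^t* *m A *m U + U^t* *m E *m U.
  by rewrite mulmxDr mulmxDl.
rewrite TE in upT *; have := strict_lower_part_perturbation upT.
rewrite strict_upper_partD.
move: (delta_sqr_ge (U^t* *m A *m U) hn) (delta_sqr_ge (U^t* *m E *m U) hn).
move: (normalmx_strict_upper_le (normalmx_conjugate unU hA) hn).
rewrite !delta_conjugate //.
set N := _ *m A *m _; set G := _ *m E *m _ => le_al leA leE lowE.
rewrite lowE frobenius_normN in le_al leA.
set x := frobenius_norm (_ + _).
set a := frobenius_norm (strict_upper_part N) in leA le_al *.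
set g := frobenius_norm (strict_upper_part G) in leE *.
set l := frobenius_norm _ in le_al leA leE.
have [a0 g0 l0 x0] : [/\ 0 <= a, 0 <= g, 0 <= l & 0 <= x].
  by rewrite !frobenius_norm_ge0.
have [leax lexa] : a <= x + g /\ x <= a + g.
  split; last exact: frobenius_normD_le.
  rewrite /g -(frobenius_normN (strict_upper_part G)).
  by apply: le_trans (frobenius_normD_le _ _); rewrite addrK.
have [dE0 dA0] : 0 <= delta E /\ 0 <= delta A by rewrite !delta_ge0.
move: a g l x (delta E) (delta A) le_al leA leE a0 g0 l0 x0 leax lexa dE0 dA0.
move=> a g l x dE dA le_al leA leE a0 g0 l0 x0 leax lexa dE0 dA0 /=.
have legx : a ^+ 2 - g ^+ 2 <= 2 * a * x - x ^+ 2 by apply: subr_sqr_le.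
set m : C := n%:R - 1 in le_al *.
have m0 : 0 <= m by rewrite subr_ge0 ler1n.
have n0 : 0 < n%:R :> C by rewrite ltr0n.
have n_ge0 : 0 <= n%:R :> C by rewrite ler0n.
have le_l : l ^+ 2 <= dE ^+ 2 by apply: le_trans leE; rewrite lerDr exprn_ge0.
have le_g : g ^+ 2 <= dE ^+ 2 by apply: le_trans leE; rewrite lerDl exprn_ge0.
have le_a : a ^+ 2 <= m / n%:R * dA ^+ 2.
  rewrite mulrAC ler_pdivlMr // mulrC (_ : n%:R = 1 + m);
    last by rewrite addrC subrK.
  rewrite mulrDl mul1r; apply: le_trans (ler_wpM2l m0 leA).
  by rewrite mulrDr [leRHS]addrC lerD2r.
have sqr_le y z : 0 <= y -> 0 <= z -> (y ^+ 2 <= z ^+ 2) = (y <= z).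
  by move=> y0 z0; rewrite ler_pXn2r ?nnegrE.
have le_asl : a <= sqrtC m * l.
  by rewrite -sqr_le ?mulr_ge0 ?sqrtC_ge0 // exprMn sqrtCK.
split; last split.
- rewrite lerBlDr.
  apply: le_trans (le_trans le_al (ler_wpM2l m0 le_l)) _.
  by rewrite lerDl exprn_ge0.
- rewrite subr_sqr; apply: le_trans (_ : x * (a + g) <= _).
    by rewrite ler_wpM2r ?addr_ge0 // lerBlDr.
  rewrite mulrC ler_wpM2r //; apply: le_trans (_ : sqrtC m * l + g <= _).
    by rewrite lerD2r.
  rewrite -sqr_le ?addr_ge0 ?mulr_ge0 ?sqrtC_ge0 //.
  rewrite exprMn sqrtCK; apply: le_trans (mulD_sqr_le _ _ _) _.
  - by rewrite ger0_real ?sqrtC_ge0.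
  - exact: ger0_real.
  - exact: ger0_real.
  by rewrite sqrtCK subrK ler_wpM2l // ltW.
- rewrite lerBlDr; apply: le_trans (_ : (x + g) ^+ 2 <= _).
    by rewrite sqr_le ?addr_ge0.
  rewrite (_ : (x + g) ^+ 2 = 2 * g * x + x ^+ 2 + g ^+ 2); last by ring.
  rewrite 2!lerD2r ler_wpM2r // ler_wpM2l //.
  by rewrite -sqr_le.
- apply: le_trans legx _; rewrite lerD2r ler_wpM2r // -mulrA ler_wpM2l //.
  apply: le_trans le_asl _; rewrite ler_wpM2l ?sqrtC_ge0 //.
  by rewrite -sqr_le.
- rewrite lerBlDr.
  by apply: le_trans le_a _; rewrite lerDl exprn_ge0.
- apply: le_trans legx _; rewrite lerD2r ler_wpM2r // -mulrA ler_wpM2l //.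
  have mn0 : 0 <= m / n%:R by rewrite divr_ge0 // ltW.
  by rewrite -sqr_le ?mulr_ge0 ?sqrtC_ge0 // exprMn sqrtCK.
Qed.

Theorem theorem3p6 (R : realType) (n : nat) (hn : (0 < n)%N)
    (A E : 'M[R[i]]_n) (lam lamt : 'I_n -> R[i]) (Ut : 'M[R[i]]_n)
    (hA : A \is normalmx)
    (hlam : has_spectrum A lam)
    (hlamt : has_spectrum (A + E) lamt)
    (hUt : schur_unitary (A + E) Ut) :
  let Delta := strict_upper_part (Ut^t* *m (A + E) *m Ut) in
  exists p : 'S_n,
    let D2 := spectral_distance2 lam lamt p in
    [/\ D2 <= sqrtC (frobenius_norm E ^+ 2 + (n%:R - 1) * delta E ^+ 2),
        D2 <= sqrtC (frobenius_norm E ^+ 2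
                     + sqrtC n%:R * delta E * frobenius_norm Delta),
        D2 <= sqrtC (frobenius_norm E ^+ 2
                     + 2 * delta E * frobenius_norm Delta
                     + frobenius_norm Delta ^+ 2),
        D2 <= sqrtC (frobenius_norm E ^+ 2
                     + 2 * sqrtC (n%:R - 1) * delta E * frobenius_norm Delta
                     - frobenius_norm Delta ^+ 2)
      & D2 <= sqrtC (frobenius_norm E ^+ 2
                     + (n%:R - 1) / n%:R * delta A ^+ 2) /\
        D2 <= sqrtC (frobenius_norm E ^+ 2
                     + 2 * sqrtC ((n%:R - 1) / n%:R) * delta A
                       * frobenius_norm Delta
                     - frobenius_norm Delta ^+ 2)].
Proof.
move=> Delta.
have [p le_p] := spectral_matching_le hA hlam hlamt hUt; exists p => D2.
have D2_le B : frobenius_norm (strict_upper_part (Ut^t* *m A *m Ut)) ^+ 2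
    - frobenius_norm (strict_upper_part (Ut^t* *m E *m Ut)) ^+ 2 <= B ->
    D2 <= sqrtC (frobenius_norm E ^+ 2 + B).
  move=> leB; apply: ler_sqrtC_of_le.
    by apply: sumr_ge0 => i _; apply: exprn_ge0.
  by apply: le_trans le_p _; rewrite -addrA lerD2l.
have [b1 b2 b3 b4 [b5 b6]] := strict_upper_part_bounds hn hA hUt.
split; first exact: D2_le.
- exact: D2_le.
- by rewrite -addrA; apply: D2_le.
- by rewrite -addrA; apply: D2_le.
split; first exact: D2_le.
by rewrite -addrA; apply: D2_le.
Qed.
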